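(* Let $A=(a_{i,j}),B=(b_{i,j})\in PL_3$ be CPLM with PLC $A_1$ and $B_1$, respectively. Suppose that $b_{x,1}=1$ for some $x>1$. Then $A\cdot B$ is given by the block matrix $$A\cdot B=\begin{pmatrix}0&\begin{matrix}0&0\end{matrix}\\ \begin{matrix}a_{2,x}\\ a_{3,x}\end{matrix}&A_1\cdot B_1\end{pmatrix}.$$
   Context: Matrices have entries in a field $k$. A $d\times d$ matrix is a Permutation-Like Matrix (PLM) if all its entries are $0$ or $1$ and each column contains exactly one entry equal to $1$; $PL_d$ is the set of all $d\times d$ PLM. $A\in PL_3$ is a canonical Permutation-Like Matrix (CPLM) if $a_{1,2}=a_{1,3}=0$ and the $2\times 2$ submatrix $A_1=(a_{i,j})_{2\le i,j\le 3}$ lies in $PL_2$; $A_1$ is called the Permutation-Like Component (PLC) of $A$. *)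

(* Defs.v *)
From mathcomp Require Import all_boot all_order all_algebra.
Set Implicit Arguments.
Unset Strict Implicit.
Unset Printing Implicit Defensive.
Import GRing.Theory.
Local Open Scope ring_scope.

(* Indices are 0-based: the usual 1-based entry a_{i,j} is [A (i-1) (j-1)]. *)

Definition is_PLM (k : fieldType) (d : nat) (A : 'M[k]_d) : Prop :=
  (forall i j, A i j = 0 \/ A i j = 1) /\
  (forall j, exists! i, A i j = 1).

(* [3] is convertible to [1 + 2], so a 3 x 3 matrix has a lower right 2 x 2
   block in the sense of [drsubmx]. *)
Definition PLC (k : fieldType) (A : 'M[k]_3) : 'M[k]_2 :=
  drsubmx (A : 'M[k]_(1 + 2)).

Definition is_CPLM (k : fieldType) (A : 'M[k]_3) : Prop :=
  [/\ is_PLM A,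
      A (inord 0) (inord 1) = 0,
      A (inord 0) (inord 2) = 0
    & is_PLM (PLC A)].

(* Main.v *)
Require Import Defs.
From mathcomp Require Import all_boot all_order all_algebra.
Set Implicit Arguments.
Unset Strict Implicit.
Unset Printing Implicit Defensive.
Import GRing.Theory.
Local Open Scope ring_scope.

(** Each column of a PLM is a standard basis vector, so multiplying by [B] on the right selects
    columns of [A] ([mulmx_PLM_entry]): the first column of [A *m B] is column [x] of [A], whose top
    entry is zero because [x > 0]. A CPLM is block lower triangular for the splitting 3 = 1 + 2
    ([CPLM_block]), and this settles the two right-hand blocks of the product. *)

(** Entries are 0 or 1 and the 1 in column [j] is unique, so only the term at [x] survives in the
    sum. *)
Lemma mulmx_PLM_entry (k : fieldType) (m d : nat) (A : 'M[k]_(m, d))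
    (B : 'M[k]_d) (x j : 'I_d) (i : 'I_m) :
  is_PLM B -> B x j = 1 -> (A *m B) i j = A i x.
Proof.
case=> B01 B1 Bxj; have [y [_ yP]] := B1 j.
rewrite mxE (bigD1 x) //= Bxj mulr1 big1 ?addr0 // => z zx.
have [->|Bzj] := B01 z j; first by rewrite mulr0.
by case/eqP: zx; rewrite -(yP _ Bzj) -(yP _ Bxj).
Qed.

Lemma CPLM_row0 (k : fieldType) (A : 'M[k]_3) (i j : 'I_3) :
  is_CPLM A -> i = 0%N :> nat -> (0 < j)%N -> A i j = 0.
Proof.
case=> _ A01 A02 _ i0 j0.
have -> : i = inord 0 by apply: val_inj; rewrite /= inordK.
have [j1|j2] : j = 1%N :> nat \/ j = 2%N :> nat.
- by case: j j0 => [[|[|[|?]]] ?] //=; [left | right].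
- by rewrite -A01; congr (A _ _); apply: val_inj; rewrite /= inordK.
- by rewrite -A02; congr (A _ _); apply: val_inj; rewrite /= inordK.
Qed.

Lemma CPLM_block (k : fieldType) (A : 'M[k]_3) :
  is_CPLM A ->
  A = block_mx (ulsubmx (A : 'M_(1 + 2))) 0 (dlsubmx (A : 'M_(1 + 2))) (PLC A).
Proof.
move=> hA; apply: etrans (esym (@submxK _ 1 2 1 2 _)) _; congr block_mx.
apply/matrixP=> i j; rewrite !mxE.
by apply: CPLM_row0 => //=; rewrite ord1.
Qed.

Theorem proposition3p5 (k : fieldType) (A B : 'M[k]_3)
    (hA : is_CPLM A) (hB : is_CPLM B)
    (x : 'I_3) (hx : (0 < x)%N) (hBx : B x (inord 0) = 1) :
  A *m B =
    block_mx (0 : 'M[k]_1) (0 : 'rV[k]_2)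
             (\col_(i < 2) A (rshift 1 i) x) (PLC A *m PLC B).
Proof.
have col0 i (j : 'I_1) : (A *m B) i (lshift 2 j) = A i x.
  have [PB _ _ _] := hB; apply: mulmx_PLM_entry => //; rewrite -hBx.
  by congr (B _ _); apply: val_inj; rewrite /= inordK ?ord1.
(* Block sizes are explicit since 3 is [1 + 2] only up to conversion. *)
have ABr := etrans (congr2 mulmx (CPLM_block hA) (CPLM_block hB))
  (@mulmx_block _ 1 2 1 2 1 2 _ _ _ _ _ _ _ _).
(* Compare the four blocks: [col0] gives the left ones, [ABr] the right ones. *)
apply: etrans (esym (@submxK _ 1 2 1 2 _)) _; congr block_mx.
- by apply/matrixP=> i j; rewrite 2![LHS]mxE col0 mxE (CPLM_row0 hA) //= ord1.
- by rewrite ABr block_mxKur !(mulmx0, mul0mx, addr0).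
- by apply/matrixP=> i j; rewrite 2![LHS]mxE col0 mxE.
- by rewrite ABr block_mxKdr mulmx0 add0r.
Qed.
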